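(* Let $S$ be an infinite set, let $m,n\in\mathbb{N}$, let $\boldsymbol{s}=(s_1,\dots,s_m)\in S^m$, and let $f_1,\dots,f_m:S^{n+1}\to S$. Write $\sigma(x_1,\dots,x_{n+1})=\boldsymbol{s}$ for the system $f_j(x_1,\dots,x_{n+1})=s_j$, $j=1,\dots,m$. Suppose there exists $k\in\mathbb{N}$ such that for every $t\in S$ the number of tuples $(x_1,\dots,x_n)\in S^n$ with $\sigma(x_1,\dots,x_n,t)=\boldsymbol{s}$ is at most $k$. Then the following are equivalent: (1) the system $\sigma(x_1,\dots,x_{n+1})=\boldsymbol{s}$ is partition regular over $S$; (2) the set of witnesses of the partition regularity of the system is non-empty, and for every such witness $\mathcal{U}$ there exists $B\in\mathcal{U}$ such that every solution $(b_1,\dots,b_{n+1})\in B^{n+1}$ of the system is constant (i.e. $b_1=\dots=b_{n+1}$); (3) there is a finite coloring $c_0$ of $S$ such that (a) the system has a $c_0$-monochromatic solution, and (b) every $c_0$-monochromatic solution of the system is constant.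
   Context: A finite coloring of $S$ is a map $c:S\to\{1,\dots,r\}$ for some $r\in\mathbb{N}$; elements $a_1,\dots,a_{n+1}$ are $c$-monochromatic if $c(a_1)=\dots=c(a_{n+1})$. The system is partition regular (PR) over $S$ if for every $r\in\mathbb{N}$ and every coloring $c:S\to\{1,\dots,r\}$ there exist $c$-monochromatic $a_1,\dots,a_{n+1}\in S$ with $\sigma(a_1,\dots,a_{n+1})=\boldsymbol{s}$. A witness of the partition regularity of the system is an ultrafilter $\mathcal{U}$ on $S$ such that for every $A\in\mathcal{U}$ there are $a_1,\dots,a_{n+1}\in A$ with $\sigma(a_1,\dots,a_{n+1})=\boldsymbol{s}$. A solution is constant if all its entries are equal. *)

(* Defs.v *)
From mathcomp Require Import all_boot.
From mathcomp Require Import boolp classical_sets functions cardinality filter.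

Set Implicit Arguments.
Unset Strict Implicit.
Unset Printing Implicit Defensive.

Local Open Scope classical_set_scope.

Definition solution (S : Type) (m n : nat)
    (f : 'I_m -> n.+1.-tuple S -> S) (s : m.-tuple S) (x : n.+1.-tuple S) : Prop :=
  forall j : 'I_m, f j x = tnth s j.

Definition constant_tuple (T : Type) (n : nat) (x : n.-tuple T) : Prop :=
  forall i j : 'I_n, tnth x i = tnth x j.

Definition monochromatic (S : Type) (r n : nat) (c : S -> 'I_r)
    (x : n.-tuple S) : Prop :=
  forall i j : 'I_n, c (tnth x i) = c (tnth x j).

Definition tuple_in (S : Type) (n : nat) (A : set S) (x : n.-tuple S) : Prop :=
  forall i : 'I_n, A (tnth x i).

Definition partition_regular (S : Type) (m n : nat)
    (f : 'I_m -> n.+1.-tuple S -> S) (s : m.-tuple S) : Prop :=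
  forall (r : nat) (c : S -> 'I_r),
    exists a : n.+1.-tuple S, monochromatic c a /\ solution f s a.

Definition witness (S : Type) (m n : nat)
    (f : 'I_m -> n.+1.-tuple S -> S) (s : m.-tuple S) (U : set_system S) : Prop :=
  UltraFilter U /\
  forall A : set S, U A ->
    exists a : n.+1.-tuple S, tuple_in A a /\ solution f s a.

(* Main.v *)
(**
The fibre bound describes the solutions by finitely many self-maps of [S]: for
[i < k] and [j < n] let [g i j t] be the [j]-th entry of the [i]-th tuple [x]
such that [(x, t)] is a solution. For every self-map [g] there is a finite
coloring in which [g x] and [x] have the same color only when [g x = x]; the
product [c0] of the colorings obtained for the maps [g i j] is finite, and all its
monochromatic solutions are constant. Each of the conditions (1)-(3) then provides
a constant solution [(t, ..., t)]; conversely such a solution is monochromatic for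
every coloring, and the principal ultrafilter at [t] is a witness. Finally, every
ultrafilter contains a color class of [c0], which serves as the set [B] in (2).
*)

Require Import Defs.
From mathcomp Require Import all_boot zify.
From mathcomp Require Import boolp classical_sets functions cardinality filter.

Set Implicit Arguments.
Unset Strict Implicit.
Unset Printing Implicit Defensive.

Local Open Scope classical_set_scope.
Local Open Scope card_scope.

Lemma ex_least_nat (P : nat -> Prop) :
  (exists n, P n) -> exists n, P n /\ forall k, P k -> n <= k.
Proof.
move=> exP.
have exb : exists n, `[< P n >] by case: exP => n Pn; exists n; apply/asboolP.
case: (ex_minnP exb) => n /asboolP Pn minn.
by exists n; split=> // k Pk; apply/minn/asboolP.
Qed.

(** [R x] relates [x] to the points whose forward orbit meets its own. [R x] and [R (g x)] agree,
    and canonical choice depends only on the predicate. *)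
Lemma orbit_representative (S : choiceType) (g : S -> S) :
  exists rep : S -> S,
    (forall x, rep (g x) = rep x) /\
    (forall x, exists a b, iter a g x = iter b g (rep x)).
Proof.
pose R x y := `[< exists a b, iter a g x = iter b g y >].
have Rg x : R (g x) =1 R x.
  move=> y; apply/asboolP/asboolP => -[a [b e]].
    by exists a.+1, b; rewrite iterSr.
  by exists a, b.+1; rewrite -iterSr /= e.
have Rxx x : R x x by apply/asboolP; exists 0, 0.
have Rxg x : R x (g x) by apply/asboolP; exists 1, 0.
exists (fun x => choose (R x) x); split=> x.
  by rewrite (eq_choose (Rg x)); apply: choose_id.
exact/asboolP/(chooseP (Rxx x)).
Qed.

Lemma self_map_coloring (S : choiceType) (g : S -> S) :
  exists c : S -> bool * bool * bool, forall x, c (g x) = c x -> g x = x.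
Proof.
have [rep [repg repP]] := orbit_representative g.
have rep_iter a x : rep (iter a g x) = rep x.
  by elim: a => //= a <-.
pose orb y := exists b, y = iter b g (rep y).
have orbg y : orb y -> orb (g y).
  by case=> b yE; exists b.+1; rewrite repg /= -yE.
have /choice[a aP] x : exists n,
    orb (iter n g x) /\ forall k, orb (iter k g x) -> n <= k.
  apply: ex_least_nat; have [a [b e]] := repP x.
  by exists a, b; rewrite rep_iter.
have /choice[b bP] x : exists n, orb x ->
    x = iter n g (rep x) /\ forall k, x = iter k g (rep x) -> n <= k.
  have [/ex_least_nat[n nP]|nx] := pselect (orb x); first by exists n.
  by exists 0.
have a0 x : orb x -> a x = 0.
  by move=> ox; have [_ /(_ 0 ox)] := aP x; rewrite leqn0 => /eqP.
have orb_a0 x : a x = 0 -> orb x by move=> ax; have [] := aP x; rewrite ax.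
have bg x : orb x -> b (g x) <= (b x).+1.
  move=> ox; have [_] := bP _ (orbg _ ox); apply.
  by rewrite repg /= -(bP _ ox).1.
(* [a x] is the distance from [x] to the forward orbit of [rep x] and [b x] the
   position on that orbit. A step decrements [a] off the orbit and increments
   [b] on it, except at the single point closing the cycle; the last component
   singles out this point. *)
exists (fun x => (a x == 0, odd (if a x == 0 then b x else a x),
                  b (g x) == (b x).+1)) => x [].
have [ax|ax] := eqVneq (a x) 0.
  have ox := orb_a0 _ ax; have ogx := orbg _ ox.
  rewrite (a0 _ ogx) eqxx => _ oddb.
  have [bgE|bgN] := eqVneq (b (g x)) (b x).+1.
    by move: oddb; rewrite bgE /=; case: odd.
  move=> /eqP bggN; have bgx := bg _ ox; have bggx := bg _ ogx.
  have [xE bmin] := bP _ ox; have [gxE _] := bP _ ogx.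
  have [bE|bN] := eqVneq (b (g x)) (b x).
    by rewrite gxE repg bE -xE.
  have lt_b : b (g x) < b x by lia.
  have [ggxE _] := bP _ (orbg _ ogx).
  (* Here [b (g (g x)) <= b (g x)], so passing through [g (g x)] reaches [x] from [rep x] in fewer
     than [b x] steps, against minimality. *)
  have /bmin : x = iter (b x - (b (g x)).+1 + b (g (g x))) g (rep x).
    rewrite iterD; have -> : rep x = rep (g (g x)) by rewrite !repg.
    rewrite -ggxE {2}gxE repg -iterS -iterD subnK //.
  lia.
(* Off the orbit [a] drops by exactly one, so its parity changes. *)
have [oa _] := aP x; have [oag _] := aP (g x).
have le1 : a (g x) <= (a x).-1.
  by have [_] := aP (g x); apply; rewrite -iterSr prednK // lt0n.
have le2 : a x <= (a (g x)).+1.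
  by have [_] := aP x; apply; rewrite iterSr.
have aE : a x = (a (g x)).+1 by lia.
by move=> ->; rewrite aE /=; case: odd.
Qed.

Lemma rcons_tuple_widen (T : Type) (n : nat) (a : n.+1.-tuple T) :
  a = [tuple of rcons [tuple tnth a (widen_ord (leqnSn n) i) | i < n]
                      (tnth a ord_max)].
Proof.
apply: val_inj; rewrite /= -[LHS]map_tnth_enum enum_ordSr map_rcons.
by rewrite -map_comp.
Qed.

(** [h t] numbers the fiber over [t] injectively below [k]; outside the fiber its values are
    arbitrary. *)
Lemma finite_fibers_enum (X T : Type) (k n : nat) (P : n.-tuple X -> T -> Prop) :
  (forall t, [set x | P x t] #<= `I_k) ->
  exists h : T -> n.-tuple X -> nat, forall t,
    (forall x, P x t -> h t x < k) /\
    (forall x y, P x t -> P y t -> h t x = h t y -> x = y).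
Proof.
move=> fib.
pose Q t (ht : n.-tuple X -> nat) := (forall x, P x t -> ht x < k) /\
  (forall x y, P x t -> P y t -> ht x = ht y -> x = y).
suff /choice[h hP] : forall t, exists ht, Q t ht by exists h.
move=> t; have /pcard_leP/unsquash f := fib t.
exists f; split=> [x Px|x y Px Py e].
  exact: (funS (s := f) x Px).
by apply: (inj (f := f)) e; exact: mem_set.
Qed.

Lemma coloring_constant_solutions (S : Type) (m n : nat) (s : m.-tuple S)
    (f : 'I_m -> n.+1.-tuple S -> S) :
  (exists k : nat, forall t : S,
     [set x : n.-tuple S | solution f s [tuple of rcons x t]] #<= `I_k) ->
  exists (r : nat) (c0 : S -> 'I_r), forall a : n.+1.-tuple S,
    monochromatic c0 a -> solution f s a -> constant_tuple a.
Proof.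
case=> k /finite_fibers_enum[h hP].
have /choice[g gP] (p : 'I_k * 'I_n) : exists g : S -> S,
    forall t (x : n.-tuple S), solution f s [tuple of rcons x t] ->
      h t x = p.1 -> g t = tnth x p.2.
  pose Q t y := forall x : n.-tuple S, solution f s [tuple of rcons x t] ->
    h t x = p.1 -> y = tnth x p.2.
  suff /choice[h' h'P] : forall t, exists y, Q t y by exists h'.
  move=> t; have [[x [sx hx]]|nx] := pselect (exists x : n.-tuple S,
      solution f s [tuple of rcons x t] /\ h t x = p.1); last first.
    (* If no tuple over [t] has number [p.1], the default value is [t]. *)
    by exists t => x sx hx; case: nx; exists x.
  exists (tnth x p.2) => y sy hy; congr tnth.
  by apply: (hP t).2 => //; rewrite hx hy.
have /choice[c cP] p := @self_map_coloring {classic S} (g p).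
pose C t := [ffun p => c p t]; exists #|{: {ffun 'I_k * 'I_n -> bool * bool * bool}}|.
exists (enum_rank \o C) => a amono asol.
suff last_eq i : tnth a i = tnth a ord_max by move=> i j; rewrite !last_eq.
have [->//|iN] := eqVneq i ord_max.
have ltin : i < n.
  by rewrite ltn_neqAle -ltnS ltn_ord andbT; apply: contra iN => /eqP e; apply/eqP/val_inj.
move: asol; rewrite {1}(rcons_tuple_widen a).
set x := [tuple _ | _ < _]; set t := tnth a _ => xsol.
(* The number of [x] in its fiber and the position [i] select the self-map taking the last entry to
   the [i]-th. *)
pose p := (Ordinal ((hP t).1 x xsol), Ordinal ltin).
have gt : g p t = tnth a i.
  rewrite (gP p t x xsol) // tnth_mktuple; congr tnth; exact: val_inj.
rewrite -gt; apply: (cP p).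
have /enum_rank_inj/ffunP/(_ p) := amono i ord_max.
by rewrite !ffunE -gt.
Qed.

(** Otherwise all complements of the color classes lie in [U]; so does their finite intersection,
    which is empty. *)
Lemma ultra_color_class (T : Type) (r : nat) (c : T -> 'I_r) (U : set_system T) :
  UltraFilter U -> exists i, U [set x | c x = i].
Proof.
move=> UU; apply: contrapT => nU.
have /filter_forall : forall i, U (~` [set x | c x = i]).
  move=> i; have [Ui|//] := in_ultra_setVsetC [set x | c x = i] UU.
  by case: nU; exists i.
move=> /filter_ex[x /(_ (c x))]; exact.
Qed.

Lemma constant_solution_witness (S : Type) (m n : nat) (s : m.-tuple S)
    (f : 'I_m -> n.+1.-tuple S -> S) (a : n.+1.-tuple S) :
  constant_tuple a -> solution f s a ->
  witness f s (principal_filter (tnth a ord0)).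
Proof.
move=> acst asol; split; first exact: principal_filter_ultra.
move=> A /principal_filterP At; exists a; split=> // i.
by rewrite (acst i ord0).
Qed.

Theorem mainTheorem1 (S : Type) (S_infinite : infinite_set [set: S])
    (m n : nat) (s : m.-tuple S) (f : 'I_m -> n.+1.-tuple S -> S)
    (finite_fibers : exists k : nat, forall t : S,
       [set x : n.-tuple S | solution f s [tuple of rcons x t]] #<= `I_k) :
  [<-> (* 1 *)
       partition_regular f s;
       (* 2 *)
       [set U | witness f s U] !=set0 /\
       (forall U : set_system S, witness f s U ->
          exists B : set S, U B /\
            forall b : n.+1.-tuple S,
              tuple_in B b -> solution f s b -> constant_tuple b);
       (* 3 *)
       exists (r : nat) (c0 : S -> 'I_r),
         (exists a : n.+1.-tuple S, monochromatic c0 a /\ solution f s a) /\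
         (forall a : n.+1.-tuple S,
            monochromatic c0 a -> solution f s a -> constant_tuple a)].

Proof.
have [r [c0 c0P]] := coloring_constant_solutions finite_fibers.
tfae.
- move=> PR; split.
    have [a [amono asol]] := PR r c0.
    exists (principal_filter (tnth a ord0)).
    exact: constant_solution_witness (c0P a amono asol) asol.
  move=> U [UU _]; have [i Ui] := ultra_color_class c0 UU.
  exists [set x | c0 x = i]; split=> // b bi; apply: c0P => j l.
  by rewrite (bi j) (bi l).
(* Being a witness, [U] yields a solution inside [B], which [B] forces to be constant. *)
- move=> [[U wU] Ucst]; have [B [UB Bcst]] := Ucst U wU.
  have [a [aB asol]] := wU.2 B UB.
  exists r, c0; split=> //; exists a; split=> // i j.
  by rewrite (Bcst a aB asol i j).
- move=> [r' [c [[a [amono asol]] ccst]]] q d; exists a; split=> // i j.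
  by rewrite (ccst a amono asol i j).
Qed.
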